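(* Fix $\alpha>0$. Let $c>0$ be a sufficiently small constant. Then there is a constant $c_1>0$ such that the following holds for all sufficiently large $n$. Let $d$ be an integer with $0\le d\le n^{c}$, let $p$ be a prime with $p\le\exp(n^{c})$, let $M$ be a random $n\times n$ matrix whose entries are iid copies of an $\alpha$-balanced random variable $\xi$ in $\mathbb{F}_p$, and let $X_1,\dots,X_{n-d}\in\mathbb{F}_p^n$ be the first $n-d$ columns of $M$. Then with probability at least $1-\exp(-c_1 n)$ with respect to $X_1,\dots,X_{n-d}$, every non-zero vector $\mathbf{w}=(w_1,\dots,w_n)\in\mathbb{F}_p^n$ that is orthogonal to $W_{n-d}=\langle X_1,\dots,X_{n-d}\rangle$ satisfies $$\sup_{a\in\mathbb{F}_p}\Big|\mathbf{P}\Big(\sum_{i=1}^n\xi_iw_i=a\Big)-\frac1p\Big|\le\exp(-n^{c}),$$ where $\xi_1,\dots,\xi_n$ are iid copies of $\xi$ (independent of $M$, and the probability is over the $\xi_i$ with $\mathbf{w}$ fixed).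
   Context: A random variable $\xi$ taking values in $\mathbb{F}_p$ is called $\alpha$-balanced if $\max_{a\in\mathbb{F}_p}\mathbf{P}(\xi=a)\le 1-\alpha$. Orthogonality in $\mathbb{F}_p^n$ is with respect to the dot product $\mathbf{x}\cdot\mathbf{w}=\sum_i x_iw_i$. *)

(* Defs.v *)
(* MathComp / MathComp-Analysis *)
From HB Require Import structures.
From mathcomp Require Import all_boot all_order all_algebra.
From mathcomp Require Import all_classical all_reals all_analysis.

Set Implicit Arguments.
Unset Strict Implicit.
Unset Printing Implicit Defensive.

Import Order.TTheory GRing.Theory Num.Theory.
Import numFieldNormedType.Exports.

Local Open Scope classical_set_scope.
Local Open Scope ring_scope.

(* Finite value types V carry the discrete sigma-algebra. *)
Definition discrete_rv (dT : measure_display) (T : measurableType dT)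
    (V : finType) (X : T -> V) : Prop :=
  forall U : set V, measurable (X @^-1` U).

Definition Pr (R : realType) (dT : measure_display) (T : measurableType dT)
    (P : probability T R) (A : set T) : R := fine (P A).

Definition mutually_independent (R : realType) (dT : measure_display)
    (T : measurableType dT) (P : probability T R) (I V : finType)
    (X : I -> T -> V) : Prop :=
  forall (J : {set I}) (U : I -> set V),
    Pr P (\bigcap_(i in [set` J]) (X i @^-1` U i)) =
    \prod_(i in J) Pr P (X i @^-1` U i).

(* The copies X i and the original xi may live on different spaces. *)
Definition iid_copies (R : realType) (dT dT0 : measure_display)
    (T : measurableType dT) (P : probability T R)
    (T0 : measurableType dT0) (P0 : probability T0 R)
    (I V : finType) (X : I -> T -> V) (xi : T0 -> V) : Prop :=
  [/\ forall i, discrete_rv (X i),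
      forall i (U : set V), Pr P (X i @^-1` U) = Pr P0 (xi @^-1` U) &
      mutually_independent P X].

(* Probabilities are nonnegative and 'F_p is nonempty, so the default 0 of the
   iterated maximum is harmless. *)
Definition balanced (R : realType) (dT : measure_display)
    (T : measurableType dT) (P : probability T R) (p : nat) (alpha : R)
    (xi : T -> 'F_p) : Prop :=
  \big[Num.max/0]_(a : 'F_p) Pr P [set t | xi t = a] <= 1 - alpha.

Definition dotprod (F : fieldType) (n : nat) (x w : 'cV[F]_n) : F :=
  \sum_(i < n) x i 0 * w i 0.

Definition first_cols (F : fieldType) (n m : nat) (A : 'M[F]_n) :
    seq 'cV[F]_n :=
  [seq col j A | j : 'I_n <- enum 'I_n & (j < m)%N].

Definition orthogonal_to (F : fieldType) (n : nat) (w : 'cV[F]_n)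
    (W : {vspace 'cV[F]_n}) : Prop :=
  forall x, x \in W -> dotprod x w = 0.

(* sup over a of | P(x_1 w_1 + ... + x_n w_n = a) - 1/p | *)
Definition conc_dev (R : realType) (dT : measure_display)
    (T : measurableType dT) (P : probability T R) (p n : nat)
    (x : 'I_n -> T -> 'F_p) (w : 'cV['F_p]_n) : R :=
  sup [set `|Pr P [set t | \sum_(i < n) x i t * w i 0 = a] - p%:R^-1|
      | a in [set: 'F_p]].

(* Main.v *)
Require Import Defs.
From HB Require Import structures.
From mathcomp Require Import all_boot all_order all_algebra.
From mathcomp Require Import complex ring lra zify.
From mathcomp Require Import all_classical all_reals all_analysis.

(* Let phi be the characteristic function of xi and u = 1 - |phi|^2; u is even,
   bounded by 1 and satisfies u (s + t) <= 2 u s + 2 u t. By Fourier inversion,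
   if w violates the bound then T = {t : sum_i u (t w_i) <= 2 L}, L = n^c, has a
   nonzero element, and P(X . w = 0) = O(|T| / p) for a random column X. A second
   moment computation shows that all but O(p / |T|) values s have
   sum_(t in T) u (t s) >= (alpha / 8) |T|, and O(L) elements t_1, ..., t_r of T
   suffice to detect all these s. Hence A = {s : sum_j u (t_j s) small}, whose
   iterated sumsets still avoid the detected s, has O(p / |T|) elements with a
   small constant, unless A = {0}; in both cases
   |A| P(X . w = 0) <= 1 - alpha / 2. All but O(L^2) coordinates of w lie in A.
   In the union bound over w, organized by the tuple (t_1, ..., t_r), the
   roughly |A|^n vectors w for a given tuple therefore cancel against
   P(X . w = 0)^(n - d), which leaves exp (O(L^3)) (1 - alpha / 4)^n. *)

Set Implicit Arguments.
Unset Strict Implicit.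
Unset Printing Implicit Defensive.

Import Order.TTheory GRing.Theory Num.Theory.
Import numFieldNormedType.Exports.

Local Open Scope ring_scope.

(** * Additive characters of the prime field *)

Lemma exists_additive_character (C : numClosedFieldType) (p : nat) :
  prime p -> exists e : 'F_p -> C,
  [/\ {morph e : x y / x + y >-> x * y}, forall x, `|e x| = 1 &
      forall x, x != 0 -> \sum_t e (t * x) = 0].
Proof.
move=> p_pr; have p_gt1 := prime_gt1 p_pr.
have p_gt0 := prime_gt0 p_pr.
(* A root of [1 + X + ... + X ^ (p - 1)] is a [p]-th root of unity, and it is not 1 because that sum
   at 1 is [p]. The character is [x |-> z ^+ x]. *)
have [z z_root] : exists z : C, root (\poly_(i < p) 1) z.
  apply/closed_rootP; rewrite size_poly_eq ?oner_eq0//.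
  by rewrite neq_ltn p_gt1 orbT.
have z_sum : \sum_(i < p) z ^+ i = 0.
  move: z_root; rewrite /root horner_poly => /eqP z0; rewrite -[RHS]z0.
  by apply: eq_bigr => i _; rewrite mul1r.
have zp : z ^+ p = 1 by apply/eqP; rewrite -subr_eq0 subrX1 z_sum mulr0.
have zq : z ^+ (Zp_trunc (pdiv p)).+2 = 1 by rewrite Fp_cast.
have z1 : z != 1.
  apply/eqP => z1; move/eqP: z_sum; rewrite z1.
  under eq_bigr do rewrite expr1n.
  by rewrite sumr_const card_ord pnatr_eq0 eqn0Ngt p_gt0.
have z_norm : `|z| = 1.
  apply/eqP; rewrite -(@pexpr_eq1 _ _ p) ?normr_ge0//.
  by rewrite -normrX zp normr1.
have zD : {morph (fun x : 'F_p => z ^+ x) : x y / x + y >-> x * y}.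
  by move=> x y; rewrite /= -exprD expr_mod.
exists (fun x : 'F_p => z ^+ x); split => //.
- by move=> x; rewrite normrX z_norm expr1n.
move=> x x_neq0.
have -> : \sum_t z ^+ (t * x)%R = \sum_(t : 'F_p) z ^+ t.
  by rewrite [RHS](reindex_inj (mulIf x_neq0)).
(* Shifting the index by 1 multiplies the sum by [z], and [z != 1]. *)
have : z * (\sum_(t : 'F_p) z ^+ t) = \sum_(t : 'F_p) z ^+ t.
  rewrite mulr_sumr [RHS](reindex_inj (addrI (1 : 'F_p))).
  by apply: eq_bigr => t _; rewrite [RHS]zD expr1.
by move/eqP; rewrite -[X in _ == X]mul1r -subr_eq0 -mulrBl mulf_eq0 subr_eq0
  (negPf z1) => /eqP.
Qed.

(** * Characteristic function and energy of a balanced law *)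

Section Energy.
Variables (R : realType) (F : finFieldType) (mu : F -> R) (alpha : R).
Variable e : F -> R[i].
Hypotheses (mu_ge0 : forall a, 0 <= mu a) (mu_sum1 : \sum_a mu a = 1).
Hypothesis mu_le : forall a, mu a <= 1 - alpha.
Hypotheses (eD : {morph e : x y / x + y >-> x * y})
  (e_norm : forall x, `|e x| = 1)
  (e_sum : forall x, x != 0 -> \sum_t e (t * x) = 0).

Let kappa x := complex.Re (e x).

Let e0 : e 0 = 1.
Proof.
have e00 : e 0 != 0 by rewrite -normr_eq0 e_norm oner_neq0.
by apply: (mulfI e00); rewrite -eD addr0 mulr1.
Qed.

Let eN x : e (- x) = (e x)^*.
Proof.
have ex0 : e x != 0 by rewrite -normr_eq0 e_norm oner_neq0.
by apply: (mulfI ex0); rewrite -eD subrr e0 -normCK e_norm expr1n.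
Qed.

Let e_sqr x : complex.Re (e x) ^+ 2 + complex.Im (e x) ^+ 2 = 1.
Proof. by apply: complexI; rewrite add_Re2_Im2 e_norm expr1n. Qed.

Let ReM' (z w : R[i]) : complex.Re (z * w) =
  complex.Re z * complex.Re w - complex.Im z * complex.Im w.
Proof. by case: z w => [? ?] []. Qed.

Let kappaN x : kappa (- x) = kappa x.
Proof. by rewrite /kappa eN; case: (e x). Qed.

Let kappa0 : kappa 0 = 1.
Proof. by rewrite /kappa e0. Qed.

Let kappa_le1 x : kappa x <= 1.
Proof. by have := e_sqr x; rewrite -/(kappa x) => ?; nra. Qed.

Let Re_sum (I : finType) (P : pred I) (z : I -> R[i]) :
  complex.Re (\sum_(i | P i) z i) = \sum_(i | P i) complex.Re (z i).
Proof. by apply: big_morph => [[? ?] []|]. Qed.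

Let Re_scale (x : R) (z : R[i]) : complex.Re (x%:C%C * z) = x * complex.Re z.
Proof. by case: z => [a b] /=; rewrite mul0r subr0. Qed.

Let kappa_sum x : x != 0 -> \sum_t kappa (t * x) = 0.
Proof. by move=> x0; rewrite -Re_sum e_sum. Qed.

Let kappaM x y : kappa x * kappa y = (kappa (x + y) + kappa (x - y)) / 2.
Proof.
rewrite /kappa !eD eN; case: (e x) (e y) => [a b] [c d] /=.
by field.
Qed.

(** As [1 - kappa x] is [|1 - e x| ^+ 2 / 2], this is the triangle inequality followed by
    Cauchy-Schwarz. The two squares in the proof add up to twice the gap. *)
Let kappa_double x y :
  1 - kappa (x + y) <= 2 * (1 - kappa x) + 2 * (1 - kappa y).
Proof.
rewrite /kappa eD ReM'; have := e_sqr x; have := e_sqr y.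
set a := complex.Re (e x); set b := complex.Im (e x).
set c := complex.Re (e y); set d := complex.Im (e y) => h1 h2.
have := sqr_ge0 (a + c - 2); have := sqr_ge0 (d - b); nra.
Qed.

(** This is [1 - |phi s| ^+ 2], expanded over two independent copies of the variable, so that
    inequalities can be checked term by term. *)
Definition energy (s : F) : R :=
  \sum_a \sum_b mu a * mu b * (1 - kappa (s * (a - b))).

Let mumu_ge0 a b : 0 <= mu a * mu b.
Proof. exact: mulr_ge0. Qed.

Lemma energy_ge0 s : 0 <= energy s.
Proof.
apply: sumr_ge0 => a _; apply: sumr_ge0 => b _.
by rewrite mulr_ge0 ?subr_ge0.
Qed.

Lemma energy0 : energy 0 = 0.
Proof.
by rewrite /energy big1 // => a _; rewrite big1 // => b _; rewrite mul0r kappa0 subrr mulr0.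
Qed.

Lemma energyN s : energy (- s) = energy s.
Proof.
by apply: eq_bigr => a _; apply: eq_bigr => b _; rewrite mulNr kappaN.
Qed.

Lemma energyD s t : energy (s + t) <= 2 * energy s + 2 * energy t.
Proof.
rewrite /energy !mulr_sumr -big_split; apply: ler_sum => a _.
rewrite !mulr_sumr -big_split; apply: ler_sum => b _ /=.
rewrite mulrDl (mulrCA 2) (mulrCA 2) -mulrDr.
by apply: ler_wpM2l; [exact: mumu_ge0|exact: kappa_double].
Qed.

Let sum_mumu : \sum_a \sum_b mu a * mu b = 1.
Proof. by under eq_bigr do rewrite -mulr_sumr mu_sum1 mulr1. Qed.

Definition phi (s : F) : R[i] := \sum_b (mu b)%:C%C * e (s * b).

Let phi_sqr s : `|phi s| ^+ 2 = (1 - energy s)%:C%C.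
Proof.
rewrite -[LHS]RRe_real ?rpredX ?normr_real//; congr (_%:C%C).
rewrite normCK /phi rmorph_sum mulr_suml Re_sum.
rewrite -[in RHS]sum_mumu /energy -sumrB; apply: eq_bigr => a _.
rewrite mulr_sumr Re_sum -sumrB; apply: eq_bigr => b _.
rewrite [X in _ * e (s * a) * X](_ : _ = (mu b)%:C%C * e (- (s * b))); last first.
  rewrite rmorphM eN; congr (_ * _).
  by apply: CrealP; apply/complex_realP; exists (mu b).
rewrite mulrACA -eD -mulrBr -rmorphM Re_scale /kappa.
by ring.
Qed.

Lemma energy_le1 s : energy s <= 1.
Proof. by rewrite -subr_ge0 -ler0c -phi_sqr exprn_ge0. Qed.

(** Squaring turns it into [1 - u <= (1 - u / 2) ^+ 2] with [u = energy s]. *)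
Let phi_le s : `|phi s| <= (1 - energy s / 2)%:C%C.
Proof.
have := energy_ge0 s; have := energy_le1 s => u1 u0.
rewrite -(@ler_pXn2r _ 2) ?nnegrE ?normr_ge0// ?ler0c; last lra.
by rewrite phi_sqr -rmorphXn lecR; nra.
Qed.

Let q : R := #|F|%:R.

Let q_gt0 : 0 < q.
Proof. by rewrite ltr0n; apply/card_gt0P; exists 0. Qed.

Let q_kappa y : \sum_t kappa (t * y) = q * (y == 0)%:R.
Proof.
have [->|y0] := eqVneq y 0; last by rewrite mulr0 kappa_sum.
under eq_bigr do rewrite mulr0 kappa0.
by rewrite sumr_const mulr1.
Qed.

(** The probability that two independent copies differ. *)
Let offdiag : R := \sum_a \sum_(b | b != a) mu a * mu b.

Let offdiag_ge : alpha <= offdiag.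
Proof.
rewrite -[leLHS]mul1r -mu_sum1 mulr_suml; apply: ler_sum => a _.
rewrite -mulr_sumr ler_wpM2l//.
have := mu_le a; move: mu_sum1; rewrite (bigD1 a)//=; lra.
Qed.

Let energyE s : energy s = \sum_a \sum_(b | b != a) mu a * mu b * (1 - kappa (s * (a - b))).
Proof.
apply: eq_bigr => a _; rewrite (bigD1 a)//= subrr mulr0 kappa0 subrr mulr0.
by rewrite add0r.
Qed.

(** Each pair [a != b] contributes its weight times [q], since [kappa (t * x * (a - b))] sums to 0
    over [t]. *)
Lemma energy_avg x : x != 0 -> alpha * q <= \sum_t energy (t * x).
Proof.
move=> x0; under eq_bigr do rewrite energyE.
rewrite exchange_big; apply: le_trans (_ : offdiag * q <= _).
  by rewrite ler_wpM2r// ltW.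
rewrite mulr_suml; apply: ler_sum => a _.
rewrite exchange_big mulr_suml; apply: ler_sum => b ba.
rewrite -mulr_sumr ler_wpM2l// sumrB sumr_const.
under eq_bigr do rewrite -mulrA.
by rewrite q_kappa mulf_eq0 subr_eq0 (eq_sym a) (negPf ba) (negPf x0) mulr0 subr0.
Qed.

(** Product-to-sum and orthogonality leave only [t' = t] and [t' = - t], each with weight
    [q / 2]. *)
Let kappa_second_moment (T : {set F}) x : x != 0 ->
  \sum_s (\sum_(t in T) kappa (t * (s * x))) ^+ 2 <= q * #|T|%:R.
Proof.
move=> x0.
under eq_bigr do rewrite expr2 mulr_suml.
rewrite exchange_big -sum1_card natr_sum mulr_sumr; apply: ler_sum => t tT.
under eq_bigr do rewrite mulr_sumr.
rewrite exchange_big mulr1.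
have sumE t' : \sum_s kappa (t * (s * x)) * kappa (t' * (s * x)) =
    q / 2 * ((t' == - t)%:R + (t' == t)%:R).
  under eq_bigr do rewrite kappaM -mulrDl -mulrBl mulrCA (mulrCA (t - t')).
  rewrite -mulr_suml big_split /= !q_kappa !mulf_eq0 (negPf x0) !orbF.
  rewrite subr_eq0 (eq_sym t) (addrC t) addr_eq0.
  by field.
under eq_bigr do rewrite sumE.
rewrite -mulr_sumr big_split /=.
have le1 y : \sum_(i in T) (i == y)%:R <= 1 :> R.
  have [yT|yT] := boolP (y \in T).
    by rewrite (bigD1 y)//= eqxx big1 ?addr0// => i /andP[_ /negPf->].
  rewrite big1 ?ler01// => i iT.
  by case: eqP => // iy; rewrite -iy iT in yT.
rewrite -mulrA -[leRHS]mulr1 ler_pM2l//.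
have := le1 t; have := le1 (- t); lra.
Qed.

(* Chebyshev's inequality: [2 * m * K - m ^+ 2 <= K ^+ 2] with [m] the size of
   [T] bounds the second moment of [K] from below where its mean is large. *)
Lemma card_low_energy (T : {set F}) : 0 < alpha ->
  3 * #|[set s | \sum_(t in T) energy (t * s) < alpha / 8 * #|T|%:R]|%:R *
    #|T|%:R <= 4 * q.
Proof.
move=> alpha_gt0; set B := [set s | _]; set m := #|T|%:R.
have [m0|m_gt0] := leP m 0.
  rewrite (_ : m = 0) ?mulr0; last by apply/eqP; rewrite eq_le m0 ler0n.
  by rewrite mulr_ge0// ltW.
have beta_gt0 : 0 < offdiag by exact: lt_le_trans offdiag_ge.
pose K y : R := \sum_(t in T) kappa (t * y).
pose V s : R := \sum_a \sum_(b | b != a) mu a * mu b * K (s * (a - b)) ^+ 2.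
have V_ge0 s : 0 <= V s.
  apply: sumr_ge0 => a _; apply: sumr_ge0 => b _.
  by rewrite mulr_ge0// sqr_ge0.
have V_sum : \sum_s V s <= offdiag * (q * m).
  rewrite exchange_big mulr_suml; apply: ler_sum => a _.
  rewrite exchange_big mulr_suml; apply: ler_sum => b ba.
  rewrite -mulr_sumr ler_wpM2l//; apply: kappa_second_moment.
  by rewrite subr_eq0 eq_sym.
(* The energy sum is at most [offdiag * m / 8], as [alpha <= offdiag], and
   [2 * (7 / 8) - 1 = 3 / 4]. *)
have V_low s : s \in B -> 3 / 4 * offdiag * m ^+ 2 <= V s.
  rewrite inE => /ltW sB.
  have sE : \sum_(t in T) energy (t * s) =
      \sum_a \sum_(b | b != a) mu a * mu b * (m - K (s * (a - b))).
    under eq_bigr do rewrite energyE.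
    rewrite exchange_big; apply: eq_bigr => a _.
    rewrite exchange_big; apply: eq_bigr => b _.
    rewrite -mulr_sumr sumrB sumr_const; congr (_ * (_ - _)).
    by apply: eq_bigr => t _; rewrite mulrA.
  have Vge : 2 * m * (offdiag * m - \sum_(t in T) energy (t * s)) -
      m ^+ 2 * offdiag <= V s.
    rewrite sE /offdiag /V !mulr_suml -sumrB !mulr_sumr -sumrB.
    apply: ler_sum => a _; rewrite !mulr_suml -sumrB !mulr_sumr -sumrB.
    apply: ler_sum => b _.
    rewrite -subr_ge0; set k := K _.
    have -> : mu a * mu b * k ^+ 2 - (2 * m * (mu a * mu b * m -
      mu a * mu b * (m - k)) - m ^+ 2 * (mu a * mu b)) =
      mu a * mu b * (k - m) ^+ 2 by ring.
    by rewrite mulr_ge0// sqr_ge0.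
  apply: le_trans Vge; have := offdiag_ge; nra.
have : #|B|%:R * (3 / 4 * offdiag * m ^+ 2) <= offdiag * (q * m).
  apply: le_trans V_sum.
  rewrite (bigID (mem B)) /= -[leLHS]addr0 lerD ?sumr_ge0//.
  rewrite -sum1_card natr_sum mulr_suml; apply: ler_sum => s sB.
  by rewrite mul1r V_low.
rewrite (_ : _ * _ = (3 / 4 * #|B|%:R * m) * (offdiag * m)); last by ring.
rewrite (_ : offdiag * (q * m) = q * (offdiag * m)); last by ring.
by rewrite ler_pM2r ?mulr_gt0//; lra.
Qed.

Definition linprob (I : finType) (w : I -> F) (a : F) : R :=
  \sum_(v : {ffun I -> F} | \sum_i v i * w i == a) \prod_i mu (v i).

Let q_e y : \sum_t e (t * y) = q%:C%C * (y == 0)%:R.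
Proof.
have [->|y0] := eqVneq y 0; last by rewrite mulr0 e_sum.
under eq_bigr do rewrite mulr0 e0.
by rewrite sumr_const mulr1 /q rmorph_nat.
Qed.

Let e_bigD (I : finType) (f : I -> F) : e (\sum_i f i) = \prod_i e (f i).
Proof. exact: (big_morph e eD e0). Qed.

(** Averaging [e (t * (y - a))] over [t] detects [y = a], and independence factors the transform
    over the coordinates. *)
Lemma linprob_fourier (I : finType) (w : I -> F) a :
  (q * linprob w a)%:C%C = \sum_t e (- (t * a)) * \prod_i phi (t * w i).
Proof.
have phiE t : e (- (t * a)) * \prod_i phi (t * w i) =
    \sum_(v : {ffun I -> F}) (\prod_i mu (v i))%:C%C *
      e (t * (\sum_i v i * w i - a)).
  rewrite bigA_distr_bigA mulr_sumr; apply: eq_bigr => v _.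
  rewrite big_split /= rmorph_prod -e_bigD mulrCA -eD; congr (_ * e _).
  rewrite mulrBr addrC mulr_sumr; congr (_ - _); apply: eq_bigr => i _.
  by rewrite -mulrA (mulrC (w i)).
under eq_bigr do rewrite phiE.
rewrite exchange_big /linprob big_mkcond mulr_sumr rmorph_sum.
apply: eq_bigr => v _; rewrite -mulr_sumr q_e subr_eq0.
case: ifP => _; last by rewrite !mulr0 rmorph0.
by rewrite mulr1 rmorphM mulrC.
Qed.

Let phi0 : phi 0 = 1.
Proof.
rewrite /phi; under eq_bigr do rewrite mul0r e0 mulr1.
by rewrite -rmorph_sum mu_sum1.
Qed.

Let prod_phi_le (I : finType) (w : I -> F) :
  `|\prod_i phi (w i)| <= (\prod_i (1 - energy (w i) / 2))%:C%C.
Proof.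
rewrite normr_prod rmorph_prod; apply: ler_prod => i _.
by rewrite normr_ge0 phi_le.
Qed.

(** Frequency 0 contributes exactly [q^-1] to [linprob w a]; [phi_le] bounds the rest. *)
Lemma linprob_dev (I : finType) (w : I -> F) a :
  q * `|linprob w a - q^-1| <=
    \sum_(t | t != 0) \prod_i (1 - energy (t * w i) / 2).
Proof.
have -> : q * `|linprob w a - q^-1| = `|q * linprob w a - 1|.
  rewrite -{1}(gtr0_norm q_gt0) -normrM mulrBr divff//.
  by rewrite gt_eqF.
rewrite -lecR.
have -> : `|q * linprob w a - 1|%:C%C = `|(q * linprob w a - 1)%:C%C| :> R[i].
  by rewrite normc_def /= expr0n addr0 sqrtr_sqr.
have -> : (q * linprob w a - 1)%:C%C = (q * linprob w a)%:C%C - 1 :> R[i].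
  by rewrite rmorphB rmorph1.
rewrite linprob_fourier (bigD1 0)//= mul0r oppr0 e0 mul1r.
rewrite [X in X + _ - 1]big1 => [|i _]; last by rewrite mul0r phi0.
rewrite addrC addKr rmorph_sum; apply: le_trans (ler_norm_sum _ _ _) _.
apply: ler_sum => t _; rewrite normrM e_norm mul1r.
exact: prod_phi_le.
Qed.

(** In the inversion formula every factor but the [i]-th is bounded by 1, and [energy_avg] controls
    what is left. *)
Lemma linprob_le (I : finType) (w : I -> F) a i :
  w i != 0 -> linprob w a <= 1 - alpha / 2.
Proof.
move=> wi0.
rewrite -(ler_pM2l q_gt0) -lecR.
have -> : (q * linprob w a)%:C%C = `|(q * linprob w a)%:C%C| :> R[i].
  rewrite ger0_norm // ler0c mulr_ge0 ?(ltW q_gt0)// sumr_ge0// => v _.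
  exact: prodr_ge0.
apply: le_trans (_ : (\sum_t (1 - energy (t * w i) / 2))%:C%C <= _); last first.
  rewrite lecR sumrB sumr_const -mulr_suml -[X in X - _]/q mulrBr mulr1.
  by have := energy_avg wi0; lra.
rewrite rmorph_sum.
rewrite linprob_fourier; apply: le_trans (ler_norm_sum _ _ _) _.
apply: ler_sum => t _; rewrite normrM e_norm mul1r.
apply: le_trans (prod_phi_le _) _; rewrite lecR (bigD1 i)//= ler_piMr//.
  by have := energy_le1 (t * w i); lra.
rewrite prodr_ile1// => j _; have := energy_le1 (t * w j).
by have := energy_ge0 (t * w j); lra.
Qed.

End Energy.

(** * Growth of symmetric sumsets in the prime field *)

Definition double_set (V : finZmodType) (A : {set V}) : {set V} :=
  [set x + y | x in A, y in A].

Lemma Fp_subgroup_full (p : nat) (H : {set 'F_p}) (x : 'F_p) : prime p ->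
  {in H &, forall y z, y - z \in H} -> x \in H -> x != 0 -> H = [set: 'F_p].
Proof.
move=> p_pr HB xH x0; apply/setP => y; rewrite inE.
have H0 : 0 \in H by rewrite -(subrr x) HB.
have HN z : z \in H -> - z \in H by move=> zH; rewrite -[- z]add0r HB.
rewrite -(divfK x0 y) mulrC -[y / x]natr_Zp mulr_natr.
elim: (nat_of_ord _) => [|n IHn]; first by rewrite mulr0n.
by rewrite mulrSr -[X in _ + X]opprK HB// HN.
Qed.

(* If [#|A + A| < 3/2 #|A|], any two differences of elements of [A] are both
   represented by more than half of [A], so their difference is a difference. *)
Lemma card_double_set (p : nat) (A : {set 'F_p}) (x : 'F_p) : prime p ->
  0 \in A -> {in A, forall y, - y \in A} -> x \in A -> x != 0 ->
  double_set A != [set: 'F_p] -> (3 * #|A| <= 2 * #|double_set A|)%N.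
Proof.
move=> p_pr A0 AN xA x0; set S := double_set A; apply: contraNT.
rewrite -ltnNge => S_small.
have AS y z : y \in A -> z \in A -> y + z \in S.
  by move=> yA zA; apply/imset2P; exists y z.
pose rep d := [set y in A | y - d \in A].
(* Translation by [- b] turns [rep (a + b)] into the intersection of [A - b] and [A + a]. Both lie
   in [S], as [A] is symmetric, so they share more than half of [#|A|] elements. *)
have rep_card d : d \in S -> (#|A| < 2 * #|rep d|)%N.
  move=> /imset2P[a b aA bA ->].
  pose A1 := [set y - b | y in A]; pose A2 := [set y + a | y in A].
  have -> : #|rep (a + b)| = #|A1 :&: A2|.
    rewrite -(card_imset _ (@addIr _ (- b))); apply: eq_card => z.
    rewrite !inE; apply/imsetP/andP => [[y]|[/imsetP[y yA zE] /imsetP[y' y'A]]].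
      rewrite inE => /andP[yA ydA] ->; split; first by apply/imsetP; exists y.
      by apply/imsetP; exists (y - (a + b)) => //; ring.
    rewrite zE => yE; exists y => //; rewrite inE yA /=.
    suff -> : y - (a + b) = y' by [].
    by rewrite opprD addrCA yE addrC addrK.
  have UI : (#|A1 :|: A2| + #|A1 :&: A2| = #|A| + #|A|)%N.
    by rewrite cardsUI !card_imset//; exact: addIr.
  have US : (#|A1 :|: A2| <= #|S|)%N.
    apply: subset_leq_card; rewrite finset.subUset; apply/andP; split.
      by apply/fintype.subsetP => _ /imsetP[y yA ->]; rewrite AS// AN.
    by apply/fintype.subsetP => _ /imsetP[y yA ->]; rewrite AS.
  have arith (u v s m : nat) : (u + v = m + m -> u <= s -> 2 * s < 3 * m ->
    m < 2 * v)%N by lia.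
  exact: arith UI US S_small.
(* It remains to see that [S] is closed under subtraction: it is then a subgroup with a nonzero
   element. *)
apply/eqP; apply: (@Fp_subgroup_full _ _ x p_pr) => //; last first.
  by rewrite -[x]addr0 AS.
move=> d d' /rep_card dS /rep_card d'S.
have [y] : exists y, y \in rep d :&: rep d'.
  apply/card_gt0P; have UI := cardsUI (rep d) (rep d').
  have UA : (#|rep d :|: rep d'| <= #|A|)%N.
    apply: subset_leq_card; rewrite finset.subUset.
    by apply/andP; split; apply/fintype.subsetP => y; rewrite inE => /andP[].
  have arith (u v r r' m : nat) : (u + v = r + r' -> u <= m -> m < 2 * r ->
    m < 2 * r' -> 0 < v)%N by lia.
  exact: arith UI UA dS d'S.
rewrite !inE => /andP[/andP[_ yd] /andP[_ yd']].
by rewrite (_ : d - d' = (y - d') + - (y - d)) ?AS ?AN//; ring.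
Qed.

(** Each sumset short of the whole field grows by a factor of at least 3/2. As 0 lies in [A] the
    iterates increase, so a proper [k]-th iterate has proper predecessors. *)
Lemma card_iter_double_set (p : nat) (A : {set 'F_p}) (x : 'F_p) (k : nat) :
  prime p -> 0 \in A -> {in A, forall y, - y \in A} -> x \in A -> x != 0 ->
  iter k (@double_set 'F_p) A != [set: 'F_p] ->
  (3 ^ k * #|A| <= 2 ^ k * #|iter k (@double_set 'F_p) A|)%N.
Proof.
move=> p_pr A0 AN xA x0.
have sub (D : {set 'F_p}) : 0 \in D -> D \subset double_set D.
  by move=> D0; apply/fintype.subsetP => y yD; apply/imset2P; exists y 0; rewrite ?addr0.
have I k' : let D := iter k' (@double_set 'F_p) A in
    [/\ 0 \in D, {in D, forall y, - y \in D} & x \in D].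
  elim: k' => [|k' [I0 IN Ix]] //=; split; try exact: (fintype.subsetP (sub _ I0)).
  move=> _ /imset2P[y z yI zI ->]; rewrite opprD.
  by apply/imset2P; exists (- y) (- z); rewrite ?IN.
elim: k => [|k IHk] //=; have [] := I k.
set D := iter k _ A in IHk * => D0 DN Dx D2T.
have := card_double_set p_pr D0 DN Dx x0 D2T.
have : D != [set: 'F_p].
  by apply: contraNneq D2T => DT; rewrite -finset.subTset -DT sub.
have arith (u v a b c : nat) :
    (u * a <= v * b -> 3 * b <= 2 * c -> 3 * u * a <= 2 * v * c)%N by nia.
by move=> /IHk; rewrite !expnS; exact: arith.
Qed.

(** * Greedy covering *)

Section Covering.
Variables (R : realType) (T S : finType) (P : T -> S -> bool) (g : R).
Hypothesis g_le1 : g <= 1.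

(* Each greedy step covers a proportion [g] of what is still uncovered. *)
Lemma greedy_cover (A : {set T}) (B : {set S}) (r : nat) :
  (exists t, t \in A) ->
  (forall s, s \in B -> g * #|A|%:R <= #|[set t in A | P t s]|%:R) ->
  exists2 ts : seq T, size ts = r & all (mem A) ts /\
    #|[set s in B | ~~ has (P ^~ s) ts]|%:R <= (1 - g) ^+ r * #|B|%:R.
Proof.
move=> [t0 t0A] AB; elim: r => [|r [ts <- [tsA tsB]]].
  exists [::] => //; split => //; rewrite expr0 mul1r ler_nat subset_leq_card//.
  by apply/fintype.subsetP => s; rewrite inE => /andP[].
set B' := [set s in B | _] in tsB.
(* By double counting, an average [t] in [A] covers at least [g * #|B'|] points of [B'], so some [t]
   does. *)
have [t tA tB'] : exists2 t, t \in A & g * #|B'|%:R <= #|[set s in B' | P t s]|%:R.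
  apply: contrapT => noT.
  have sum_lt : \sum_(t in A) #|[set s in B' | P t s]|%:R <
      \sum_(t in A) g * #|B'|%:R.
    apply: ltr_sum; first by apply/hasP; exists t0; rewrite ?mem_index_enum.
    by move=> t tA; rewrite ltNge; apply/negP => tB'; apply: noT; exists t.
  have sumE : \sum_(t in A) #|[set s in B' | P t s]|%:R =
      \sum_(s in B') #|[set t in A | P t s]|%:R :> R.
    have cardE (U : finType) (D : {set U}) (p : pred U) :
        #|[set x in D | p x]|%:R = \sum_(x in D) (p x)%:R :> R.
      rewrite -sum1_card natr_sum big_mkcond [RHS]big_mkcond.
      by apply: eq_bigr => x _; rewrite inE; case: (x \in D); case: (p x).
    under eq_bigr do rewrite cardE.
    by rewrite exchange_big; apply: eq_bigr => s _; rewrite cardE.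
  move: sum_lt; rewrite sumE ltNge => /negP; apply.
  rewrite sumr_const -[leLHS]mulr_natr mulrAC [leLHS]mulr_natr -sumr_const.
  by apply: ler_sum => s; rewrite inE => /andP[sB _]; rewrite AB.
exists (t :: ts) => //; split; first by rewrite /= tA.
have -> : [set s in B | ~~ has (P ^~ s) (t :: ts)] = B' :\: [set s in B' | P t s].
  by apply/finset.setP => s; rewrite !inE /=; case: (s \in B) => //=; case: (P t s); case: (has _ _).
have -> : #|B' :\: [set s in B' | P t s]|%:R =
    #|B'|%:R - #|[set s in B' | P t s]|%:R :> R.
  rewrite -(cardsID [set s in B' | P t s] B') natrD.
  rewrite (finset.setIidPr _); first by rewrite addrC addKr.
  by apply/fintype.subsetP => s; rewrite inE => /andP[].
rewrite exprS -mulrA; apply: le_trans (_ : (1 - g) * #|B'|%:R <= _); first lra.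
by rewrite ler_wpM2l// subr_ge0.
Qed.

End Covering.

(** * Points of low energy along few dilates *)

Section LowEnergyDilates.
Variables (R : realType) (p : nat) (u : 'F_p -> R) (alpha : R).
Hypotheses (p_pr : prime p) (alpha_gt0 : 0 < alpha) (alpha_le1 : alpha <= 1).
Hypotheses (u_ge0 : forall s, 0 <= u s) (u_le1 : forall s, u s <= 1).
Hypotheses (u0 : u 0 = 0) (uN : forall s, u (- s) = u s).
Hypothesis uD : forall s t, u (s + t) <= 2 * u s + 2 * u t.
Hypothesis card_low : forall T : {set 'F_p},
  3 * #|[set s | \sum_(t in T) u (t * s) < alpha / 8 * #|T|%:R]|%:R *
    #|T|%:R <= 4 * #|'F_p|%:R :> R.

Definition total_energy (ts : seq 'F_p) (s : 'F_p) : R := \sum_(t <- ts) u (t * s).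

(** The constant leaves room for five sumsets: [4 ^+ 5 * (alpha / 2 ^+ 15) = alpha / 32]. *)
Definition low_set (ts : seq 'F_p) : {set 'F_p} :=
  [set s | total_energy ts s <= alpha / 2 ^+ 15].

Lemma low_set0 ts : 0 \in low_set ts.
Proof.
rewrite inE /total_energy big1 => [|t _]; last by rewrite mulr0 u0.
by rewrite divr_ge0 ?exprn_ge0// ltW.
Qed.

Let low_setN ts : {in low_set ts, forall s, - s \in low_set ts}.
Proof.
move=> s; rewrite !inE /total_energy.
by under [X in _ -> is_true (X <= _)]eq_bigr do rewrite mulrN uN.
Qed.

Let iter_low_set ts k s : s \in iter k (@double_set 'F_p) (low_set ts) ->
  total_energy ts s <= 4 ^+ k * (alpha / 2 ^+ 15).
Proof.
elim: k s => [|k IHk] s; first by rewrite /= inE mul1r.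
move=> /imset2P[x y /IHk xk /IHk yk ->].
have : total_energy ts (x + y) <= 2 * total_energy ts x + 2 * total_energy ts y.
  rewrite /total_energy !mulr_sumr -big_split; apply: ler_sum => t _.
  by rewrite mulrDr uD.
by rewrite exprS; lra.
Qed.

(** If a tuple detects every point outside [B0], the fifth iterated sumset of its low set stays in
    [B0]. Hence the low set is trivial or smaller than [B0] by a factor [(3 / 2) ^+ 5]. *)
Lemma exists_low_set (T : {set 'F_p}) (r : nat) : (1 < #|T|)%N ->
  (1 - alpha / 16) ^+ r * #|'F_p|%:R < 1 :> R ->
  exists2 ts : r.-tuple 'F_p, all (mem T) ts &
    #|low_set ts| = 1%N \/ 5 * #|low_set ts|%:R * #|T|%:R <= #|'F_p|%:R :> R.
Proof.
move=> T_gt1 r_large.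
set q : R := #|'F_p|%:R; set m : R := #|T|%:R.
have m_ge2 : 2 <= m by rewrite ler_nat.
pose B0 := [set s | \sum_(t in T) u (t * s) < alpha / 8 * m].
have B0_card : 3 * #|B0|%:R * m <= 4 * q by exact: card_low.
have [t0 t0T] : exists t, t \in T by apply/card_gt0P; exact: ltnW.
(* Terms below [alpha / 16] account for at most half of [alpha / 8 * m], and the others are at most
   1. *)
have cover s : s \in ~: B0 ->
    alpha / 16 * m <= #|[set t in T | alpha / 16 <= u (t * s)]|%:R.
  rewrite !inE -leNgt => sB.
  have : \sum_(t in T) u (t * s) <=
      #|[set t in T | (alpha / 16 <= u (t * s))%R]|%:R + alpha / 16 * m.
    rewrite -[X in alpha / 16 * X%:R]sum1_card -sum1_card !natr_sum mulr_sumr.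
    rewrite big_mkcond [X in _ <= X + _]big_mkcond [X in _ <= _ + X]big_mkcond.
    rewrite -big_split; apply: ler_sum => t _ /=; rewrite inE.
    case: (t \in T) => /=; last by rewrite addr0.
    have := u_le1 (t * s); case: ifP => [_|/negbT]; rewrite -?ltNge; move: alpha_gt0; lra.
  by move: alpha_gt0 alpha_le1; lra.
have [|ts ts_size [tsT tsB]] :=
  @greedy_cover R _ _ (fun t s => alpha / 16 <= u (t * s)) (alpha / 16) _ T (~: B0)
    r (ex_intro _ t0 t0T) cover.
  by move: alpha_gt0 alpha_le1; lra.
(* The uncovered part has fewer than one element, so it is empty. *)
have ts_cover s : s \notin B0 -> has (fun t => alpha / 16 <= u (t * s)) ts.
  move=> sB; apply: contraT => sts.
  have : (1 - alpha / 16) ^+ r * #|~: B0|%:R < 1.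
    apply: le_lt_trans r_large; rewrite ler_wpM2l ?ler_nat ?max_card//.
    by rewrite exprn_ge0//; move: alpha_gt0 alpha_le1; lra.
  move/(le_lt_trans tsB); rewrite ltrn1 ltnS leqn0 cards_eq0 => /eqP/finset.setP/(_ s).
  by rewrite finset.in_set0 finset.in_set sts andbT finset.in_setC sB.
exists (tcast ts_size (in_tuple ts)); first by rewrite val_tcast.
rewrite val_tcast /=; set A := low_set ts.
(* Five doublings multiply the energy by at most [4 ^ 5], so it stays below
   [alpha / 32] while the covered points have energy at least [alpha / 16]. *)
have IB : iter 5 (@double_set 'F_p) A \subset B0.
  apply/fintype.subsetP => s /iter_low_set; apply: contraTT => /ts_cover.
  move=> /hasP[t tts]; rewrite -ltNge => us.
  have : u (t * s) <= total_energy ts s.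
    rewrite /total_energy (big_rem t)//= lerDl sumr_ge0//.
  by move: alpha_gt0 alpha_le1; lra.
(* As [m >= 2], [B0] fills at most two thirds of the field. *)
have B0T : B0 != [set: 'F_p].
  apply: contraTneq m_ge2 => B0T; rewrite -ltNge.
  have q_gt0 : 0 < q by rewrite ltr0n; apply/card_gt0P; exists 0.
  by move: B0_card; rewrite B0T cardsT -/q; nra.
have [A0|[x xA x0]] : A = [set 0] \/ exists2 x, x \in A & x != 0.
- have [[x xA x0]|noA] := pselect (exists2 x, x \in A & x != 0); first by right; exists x.
  left; apply/finset.setP => x; rewrite finset.in_set1; apply/idP/eqP => [xA|->]; last exact: low_set0.
  by apply/eqP; apply: contrapT => /negP x0; apply: noA; exists x.
- by left; rewrite A0 cards1.
right.
have growth : (3 ^ 5 * #|A| <= 2 ^ 5 * #|B0|)%N.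
  apply: leq_trans (_ : 2 ^ 5 * #|iter 5 (@double_set 'F_p) A| <= _)%N.
    apply: (@card_iter_double_set p A x) => //.
    - exact: low_set0.
    - exact: low_setN.
    - apply: contraNneq B0T => IT; rewrite -finset.subTset -IT//.
  by rewrite leq_mul2l subset_leq_card ?orbT.
(* The factor 5 in the conclusion comes from [32 / 243 * (4 / 3) < 1 / 5]. *)
have : 243 * #|A|%:R <= 32 * #|B0|%:R :> R by rewrite -!natrM ler_nat.
have m_ge0 : 0 <= m by rewrite ler0n.
move=> /(ler_wpM2r m_ge0).
have : 0 <= q by rewrite ler0n.
by move: B0_card; lra.
Qed.

End LowEnergyDilates.

(** * Counting the bad vectors *)

(** Give each value weight 1 on [A] and [y] off [A]. A counted vector has weight at least [y ^+ k],
    and the total weight factors over the coordinates. *)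
Lemma card_few_outside (R : realType) (F I : finType) (A : {set F}) (y : R) (k : nat) :
  0 < y -> y <= 1 ->
  #|[set w : {ffun I -> F} | (#|[set i | w i \notin A]| <= k)%N]|%:R * y ^+ k
    <= (#|A|%:R + y * #|F|%:R) ^+ #|I|.
Proof.
move=> y_gt0 y_le1; pose g x : R := if x \in A then 1 else y.
have g_sum : \sum_x g x <= #|A|%:R + y * #|F|%:R.
  rewrite (bigID (mem A)) /= lerD//.
    rewrite -sum1_card natr_sum; apply: ler_sum => x xA.
    by rewrite /g xA.
  rewrite (eq_bigr (fun=> y)) => [|x /negPf xA]; last by rewrite /g xA.
  rewrite sumr_const -[leLHS]mulr_natr mulrC [leRHS]mulrC.
  by apply: ler_wpM2r; [exact: ltW|rewrite ler_nat max_card].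
have g_ge0 x : 0 <= g x by rewrite /g; case: ifP; rewrite // ltW.
apply: le_trans (_ : (\sum_x g x) ^+ #|I| <= _); last first.
  by rewrite lerXn2r// nnegrE ?sumr_ge0// addr_ge0// mulr_ge0// ltW.
rewrite -prodr_const bigA_distr_bigA /=.
rewrite (bigID (mem [set w : {ffun I -> F} | (#|[set i | w i \notin A]| <= k)%N])) /=.
rewrite -[leLHS]addr0 lerD//; last first.
  by apply: sumr_ge0 => w _; apply: prodr_ge0.
rewrite -sum1_card natr_sum mulr_suml; apply: ler_sum => w; rewrite inE => wk.
rewrite mul1r (bigID (fun i => w i \notin A)) /=.
rewrite [X in _ * X]big1 ?mulr1 => [|i]; last by rewrite negbK /g => ->.
rewrite (eq_bigr (fun=> y)) => [|i /negPf wi]; last by rewrite /g wi.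
rewrite prodr_const; apply: ler_wiXn2l => //; first exact: ltW.
by move: wk; rewrite cardsE.
Qed.

Section BadVectors.
Variables (R : realType) (p : nat) (mu : 'F_p -> R) (alpha : R).
Variables (e : 'F_p -> R[i]) (I : finType) (L : R) (r k : nat).
Hypotheses (p_pr : prime p) (alpha_gt0 : 0 < alpha).
Hypotheses (mu_ge0 : forall a, 0 <= mu a) (mu_sum1 : \sum_a mu a = 1).
Hypothesis mu_le : forall a, mu a <= 1 - alpha.
Hypotheses (eD : {morph e : x y / x + y >-> x * y})
  (e_norm : forall x, `|e x| = 1)
  (e_sum : forall x, x != 0 -> \sum_t e (t * x) = 0).

Let q : R := #|'F_p|%:R.
Let u := energy mu e.

Hypotheses (q_le : q <= expR L) (r_large : (1 - alpha / 16) ^+ r * q < 1).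
Hypothesis k_large : r%:R * (2 * L) <= k%:R * (alpha / 2 ^+ 15).

Let q_gt0 : 0 < q.
Proof. by rewrite ltr0n; apply/card_gt0P; exists 0. Qed.

Let alpha_le1 : alpha <= 1.
Proof. by have := le_trans (mu_ge0 0) (mu_le 0); lra. Qed.

Lemma linprob_ge0 (w : I -> 'F_p) a : 0 <= linprob mu w a.
Proof. by apply: sumr_ge0 => v _; apply: prodr_ge0. Qed.

Lemma exists_low_set_of_bad (w : I -> 'F_p) (i0 : I) (a : 'F_p) : w i0 != 0 ->
  expR (- L) < `|linprob mu w a - q^-1| ->
  exists ts : r.-tuple 'F_p,
    (#|[set i | w i \notin low_set u alpha ts]| <= k)%N /\
    #|low_set u alpha ts|%:R * linprob mu w 0 <= 1 - alpha / 2.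
Proof.
move=> wi0 wa.
have u_ge0 := energy_ge0 mu_ge0 e_norm : forall s, 0 <= u s.
have u_le1 := energy_le1 mu_sum1 eD e_norm : forall s, u s <= 1.
have u0 : u 0 = 0 := energy0 mu eD e_norm.
have uN : forall s, u (- s) = u s := energyN mu eD e_norm.
have uD := energyD mu_ge0 eD e_norm : forall s t, u (s + t) <= 2 * u s + 2 * u t.
have dev := linprob_dev mu_ge0 mu_sum1 eD e_norm e_sum.
pose prod t := \prod_i (1 - u (t * w i) / 2).
have prod_le t : prod t <= expR (- (\sum_i u (t * w i) / 2)).
  rewrite -sumrN expR_sum; apply: ler_prod => i _.
  by rewrite expR_ge1Dx andbT; have := u_le1 (t * w i); lra.
have prod_le1 t : prod t <= 1.
  apply: prodr_ile1 => i _.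
  by have := u_le1 (t * w i); have := u_ge0 (t * w i); lra.
pose T := [set t : 'F_p | \sum_i u (t * w i) <= 2 * L].
have prod_small t : t \notin T -> prod t <= expR (- L).
  rewrite inE -ltNge => tT; apply: le_trans (prod_le t) _.
  by rewrite ler_expR -mulr_suml; lra.
(* Otherwise every nonzero frequency contributes at most [expR (- L)], and the deviation at [a] is
   too small. *)
have [t0 t0_neq0 t0T] : exists2 t, t != 0 & t \in T.
  apply: contrapT => noT.
  have : q * `|linprob mu w a - q^-1| <= q * expR (- L).
    apply: le_trans (dev _ w a) _.
    apply: le_trans (_ : \sum_(t | t != 0) expR (- L) <= _).
      apply: ler_sum => t t0; apply: prod_small; apply/negP => tT.
      by apply: noT; exists t.
    rewrite sumr_const -[leLHS]mulr_natr mulrC ler_wpM2r ?expR_ge0//.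
    by rewrite ler_nat max_card.
  by rewrite ler_pM2l// leNgt wa.
have L_ge0 : 0 <= 2 * L.
  by move: t0T; rewrite inE; apply: le_trans; apply: sumr_ge0.
have T0 : 0 \in T.
  by rewrite inE big1// => i _; rewrite mul0r.
have T_gt1 : (1 < #|T|)%N.
  by apply/card_gt1P; exists 0, t0; rewrite eq_sym.
set m : R := #|T|%:R; have m_ge2 : 2 <= m by rewrite ler_nat.
(* Frequency 0 gives 1, the rest of [T] at most [m - 1], and the frequencies outside [T] at most
   [q * expR (- L) <= 1]. *)
have lp0 : q * linprob mu w 0 <= m + 1.
  have tail : \sum_(t | t != 0) prod t <= m.
    rewrite (bigID (mem T)) /=.
    have T_part : \sum_(t | (t != 0) && (t \in T)) prod t <= m - 1.
      have mE : m = 1 + \sum_(t | (t != 0) && (t \in T)) 1.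
        rewrite /m -sum1_card natr_sum (bigD1 0)//=; congr (_ + _).
        by apply: eq_bigl => t; rewrite andbC.
      rewrite mE addrC addKr.
      by apply: ler_sum.
    have out_part : \sum_(t | (t != 0) && (t \notin T)) prod t <= 1.
      apply: le_trans (_ : q * expR (- L) <= _).
        apply: le_trans (_ : \sum_(t | (t != 0) && (t \notin T)) expR (- L) <= _).
          by apply: ler_sum => t /andP[_]; exact: prod_small.
        rewrite sumr_const -[leLHS]mulr_natr mulrC ler_wpM2r ?expR_ge0//.
        by rewrite ler_nat max_card.
      by rewrite expRN ler_pdivrMr ?expR_gt0// mul1r.
    by lra.
  have : q * (linprob mu w 0 - q^-1) <= m.
    apply: le_trans (le_trans (dev _ w 0) tail).
    by rewrite ler_wpM2l ?ler_norm// ltW.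
  by rewrite mulrBr divff ?gt_eqF//; lra.
have low := card_low_energy mu_ge0 mu_sum1 mu_le eD e_norm e_sum ^~ alpha_gt0.
have [ts /allP tsT ts_low] := exists_low_set p_pr alpha_gt0 alpha_le1 u_ge0 u_le1
  u0 uN uD low T_gt1 r_large.
exists ts; split.
(* Double counting: a coordinate outside the low set has total energy above [alpha / 2 ^+ 15], while
   each of the [r] entries of [ts] lies in [T] and so adds at most [2 * L]. *)
- have eps_gt0 : 0 < alpha / 2 ^+ 15 by rewrite divr_gt0 ?exprn_gt0.
  rewrite -(ler_nat R) -(ler_pM2r eps_gt0); apply: le_trans k_large.
  apply: le_trans (_ : \sum_i total_energy u ts (w i) <= _).
    rewrite (bigID (fun i => w i \notin low_set u alpha ts)) /= -[leLHS]addr0.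
    apply: lerD; last by do 2!(apply: sumr_ge0 => ? _).
    rewrite -sum1_card natr_sum mulr_suml big_mkcond [leRHS]big_mkcond.
    apply: ler_sum => i _; rewrite !inE; case: ifP => //.
    by rewrite -ltNge mul1r => /ltW.
  rewrite exchange_big /=.
  apply: le_trans (_ : \sum_(t <- ts) 2 * L <= _).
    rewrite big_seq [leRHS]big_seq; apply: ler_sum => t /tsT /=.
    by rewrite inE.
  by rewrite big_const_seq count_predT size_tuple iter_addr_0 -[leLHS]mulr_natl.
- case: ts_low => [->|low5].
    rewrite mul1r; apply: (linprob_le mu_ge0 mu_sum1 mu_le eD e_norm e_sum).
    exact: wi0.
  rewrite -(ler_pM2l q_gt0) mulrCA.
  have n_ge0 : 0 <= #|low_set u alpha ts|%:R :> R by rewrite ler0n.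
  apply: le_trans (ler_wpM2l n_ge0 lp0) _.
  have := alpha_le1; move: low5 m_ge2 n_ge0 q_gt0; rewrite -/m -/q.
  set n : R := #|low_set _ _ _|%:R; move=> h1 h2 h3 h4 h5.
  (* With [5 * n * m <= q] this gives [n * (m + 1) <= 3 / 10 * q], and [1 - alpha / 2] is at least
     1/2. *)
  have : n * (m + 1) <= n * (m * (3 / 2)) by rewrite ler_wpM2l//; lra.
  have : q * (alpha / 2) <= q * (1 / 2) by rewrite ler_pM2l//; lra.
  by lra.
Qed.

(** The left side is the expected number of bad vectors orthogonal to [m] random columns. For fixed
    [ts], the number of vectors and the bound on [linprob] carry opposite powers of [#|A ts|], which
    leaves only [#|A ts| ^+ d <= q ^+ d]. *)
Lemma bad_moment_sum (B : pred {ffun I -> 'F_p}) (eta : R) (m d : nat) :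
  (#|I| = m + d)%N -> 0 < eta -> eta <= 1 ->
  (forall w, B w -> (exists i, w i != 0) /\
    exists a, expR (- L) < `|linprob mu w a - q^-1|) ->
  \sum_(w | B w) linprob mu w 0 ^+ m <=
    q ^+ r * ((q / eta) ^+ k * q ^+ d * (1 - alpha / 2) ^+ m * (1 + eta) ^+ #|I|).
Proof.
move=> I_card eta_gt0 eta_le1 badB.
have q_ge1 : 1 <= q by rewrite ler1n; apply/card_gt0P; exists 0.
pose A (ts : r.-tuple 'F_p) := low_set u alpha ts.
pose few (ts : r.-tuple 'F_p) := [set w : {ffun I -> 'F_p} | (#|[set i | w i \notin A ts]| <= k)%N].
pose G (ts : r.-tuple 'F_p) (w : {ffun I -> 'F_p}) :=
  (w \in few ts) && (#|A ts|%:R * linprob mu w 0 <= 1 - alpha / 2).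
apply: le_trans (_ : \sum_(ts : r.-tuple 'F_p) \sum_(w | G ts w) linprob mu w 0 ^+ m <= _).
  rewrite (exchange_big_dep xpredT) //= big_mkcond; apply: ler_sum => w _.
  case: ifPn => [/badB[[i wi] [a wa]]|_]; last first.
    by apply: sumr_ge0 => ts _; apply: exprn_ge0; exact: linprob_ge0.
  have [ts [ts1 ts2]] := exists_low_set_of_bad wi wa.
  rewrite (bigD1 ts) /=; last by rewrite /G inE ts1.
  by rewrite lerDl; apply: sumr_ge0 => ? _; apply: exprn_ge0; exact: linprob_ge0.
have -> : q ^+ r = #|{: r.-tuple 'F_p}|%:R by rewrite card_tuple natrX.
rewrite mulr_natl -sumr_const; apply: ler_sum => ts _.
set s : R := #|A ts|%:R.
have A_gt0 : 0 < s.
  by rewrite ltr0n; apply/card_gt0P; exists 0; apply: low_set0 => //; exact: energy0.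
have s_le : s <= q by rewrite ler_nat max_card.
apply: le_trans (_ : #|few ts|%:R * ((1 - alpha / 2) / s) ^+ m <= _).
  rewrite -sum1_card natr_sum mulr_suml big_mkcond [leRHS]big_mkcond.
  apply: ler_sum => w _; rewrite /G; case: (w \in few ts) => //=.
  rewrite mul1r; case: ifP => [h|_]; last first.
    by rewrite exprn_ge0// divr_ge0 ?(ltW A_gt0)//; have := alpha_le1; lra.
  rewrite lerXn2r ?nnegrE ?linprob_ge0//.
    by rewrite divr_ge0 ?(ltW A_gt0)//; have := alpha_le1; lra.
  by rewrite ler_pdivlMr// mulrC.
(* This makes the weight off the low set at most [eta], hence at most [eta * s]. *)
pose y := eta / q.
have y_gt0 : 0 < y by rewrite divr_gt0.
have y_le1 : y <= 1 by rewrite ler_pdivrMr// mul1r; lra.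
have := @card_few_outside R _ I (A ts) y k y_gt0 y_le1.
rewrite -/s -/(few ts) -/q divfK ?gt_eqF// => few_le.
have few_le' : #|few ts|%:R <= (q / eta) ^+ k * (s ^+ #|I| * (1 + eta) ^+ #|I|).
  rewrite -[q / eta]invf_div -/y exprVn ler_pdivlMl ?exprn_gt0// mulrC.
  apply: le_trans few_le _; rewrite -exprMn lerXn2r ?nnegrE//.
  - by rewrite addr_ge0// ltW.
  - by rewrite mulr_ge0 ?ltW// addr_gt0.
  have s_ge1 : 1 <= s by rewrite ler1n -(ltr0n R).
  by rewrite mulrDr mulr1 lerD2l ler_peMl// ltW.
have z_ge0 : 0 <= ((1 - alpha / 2) / s) ^+ m.
  by rewrite exprn_ge0// divr_ge0 ?(ltW A_gt0)//; have := alpha_le1; lra.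
apply: le_trans (ler_wpM2r z_ge0 few_le') _.
rewrite [leLHS](_ : _ = (q / eta) ^+ k * s ^+ d * (1 - alpha / 2) ^+ m *
    (1 + eta) ^+ #|I|); last first.
  rewrite {1}I_card exprD (expr_div_n _ s); field.
  by rewrite expf_neq0 ?gt_eqF.
have eta1_ge0 : 0 <= (1 + eta) ^+ #|I| by rewrite exprn_ge0//; lra.
have a_ge0 : 0 <= (1 - alpha / 2) ^+ m by rewrite exprn_ge0//; have := alpha_le1; lra.
do 2!apply: ler_wpM2r => //.
apply: ler_wpM2l; first by rewrite exprn_ge0// divr_ge0 ?ltW.
by rewrite lerXn2r// nnegrE ltW.
Qed.

End BadVectors.

(** * Choice of the parameters *)

(** With [r] of order [L] and [k] of order [L ^+ 2], the error exponents total at most [C * L ^+ 3],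
    and [L ^+ 3] is at most the square root of [n] because [c <= 1 / 6]. The main factors give
    [expR (- (alpha / 4) * n)], half of which absorbs the errors. *)
Lemma parameter_choice (R : realType) (alpha : R) : 0 < alpha ->
  exists N : nat, forall n : nat, (N <= n)%N ->
  forall (c q : R) (d : nat), 0 < c -> c <= 6^-1 -> alpha <= 1 ->
    d%:R <= n%:R `^ c -> 1 <= q -> q <= expR (n%:R `^ c) ->
  exists r k : nat,
    [/\ (d <= n)%N, (1 - alpha / 16) ^+ r * q < 1,
        r%:R * (2 * n%:R `^ c) <= k%:R * (alpha / 2 ^+ 15) &
        q ^+ r * ((q / (alpha / 4)) ^+ k * q ^+ d * (1 - alpha / 2) ^+ (n - d) *
          (1 + alpha / 4) ^+ n) <= expR (- (alpha / 8) * n%:R)].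
Proof.
move=> alpha_gt0; have alpha_ge0 := ltW alpha_gt0.
pose Cr : R := 16 / alpha + 1.
pose Ck : R := Cr * 2 ^+ 16 / alpha + 1.
(* The summands pay for [q ^+ r], for [(q / (alpha / 4)) ^+ k] and, with 1 each, for [q ^+ d] and
   for [n - d] in place of [n]. *)
pose C : R := Cr + Ck * (1 + 4 / alpha) + 2.
have Cr_ge0 : 0 <= Cr by rewrite addr_ge0 ?divr_ge0.
have Ck_ge0 : 0 <= Ck.
  by rewrite addr_ge0 ?divr_ge0 ?mulr_ge0 ?exprn_ge0.
have a4_ge0 : 0 <= 4 / alpha by rewrite divr_ge0.
have C_ge0 : 0 <= C.
  by apply: addr_ge0 => //; apply: addr_ge0 => //; apply: mulr_ge0 => //; apply: addr_ge0.
exists (Num.truncn ((8 * C / alpha) ^+ 2)).+1 => n n_large c q d c_gt0 c_le alpha_le1.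
set L := n%:R `^ c => dL q_ge1 qL.
have n_gt0 : (0 < n)%N by exact: leq_trans n_large.
have n_ge1 : 1 <= n%:R :> R by rewrite ler1n.
have L_ge1 : 1 <= L by rewrite -(powRr0 n%:R) ler_powR// ltW.
have L_gt0 : 0 < L by exact: lt_le_trans L_ge1.
have L_ge0 := ltW L_gt0.
have L3 : L ^+ 3 <= Num.sqrt n%:R.
  rewrite -powR12_sqrt// -powR_mulrn ?powR_ge0// -powRrM ler_powR//; lra.
have L_le3 : L <= L ^+ 3 by rewrite -[leLHS]expr1 ler_weXn2l.
have L2_le3 : L ^+ 2 <= L ^+ 3 by rewrite ler_weXn2l.
have C_small : C * L ^+ 3 <= alpha / 8 * n%:R.
  have sqrt_large : 8 * C / alpha <= Num.sqrt n%:R.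
    rewrite -[leLHS]ger0_norm ?divr_ge0 ?mulr_ge0// -sqrtr_sqr.
    rewrite ler_sqrt// ltW// (lt_le_trans (truncnS_gt _))// ler_nat//.
  have -> : alpha / 8 * n%:R = (alpha / 8 * Num.sqrt n%:R) * Num.sqrt n%:R.
    by rewrite -[RHS]mulrA -expr2 sqr_sqrtr.
  apply: ler_pM => //; first by rewrite exprn_ge0.
  rewrite -[C](_ : alpha / 8 * (8 * C / alpha) = C); last by field; rewrite gt_eqF.
  by rewrite ler_wpM2l// divr_ge0.
pose r := (Num.truncn (16 * L / alpha)).+1.
pose k := (Num.truncn (r%:R * L * 2 ^+ 16 / alpha)).+1.
have r_gt : 16 * L / alpha < r%:R by rewrite truncnS_gt.
have r_le : r%:R <= Cr * L.
  have : r%:R <= 16 * L / alpha + 1.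
    by rewrite /r -natr1 lerD2r truncn_le// divr_ge0 ?mulr_ge0.
  by rewrite /Cr; lra.
have k_gt : r%:R * L * 2 ^+ 16 / alpha < k%:R by rewrite truncnS_gt.
have k_le : k%:R <= Ck * L ^+ 2.
  have : k%:R <= r%:R * L * 2 ^+ 16 / alpha + 1.
    by rewrite /k -natr1 lerD2r truncn_le// divr_ge0 ?mulr_ge0 ?exprn_ge0.
  have -> : r%:R * L * 2 ^+ 16 / alpha = r%:R * (L * 2 ^+ 16 / alpha) by rewrite !mulrA.
  have z_ge0 : 0 <= L * 2 ^+ 16 / alpha.
    by rewrite divr_ge0 ?mulr_ge0 ?exprn_ge0.
  have := ler_wpM2r z_ge0 r_le.
  have -> : Cr * L * (L * 2 ^+ 16 / alpha) = Cr * 2 ^+ 16 / alpha * L ^+ 2 by ring.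
  have : 1 <= L ^+ 2 by rewrite exprn_ege1.
  by rewrite /Ck; lra.
have dn : (d <= n)%N.
  rewrite -(ler_nat R); apply: le_trans dL _.
  by rewrite -[leRHS]powRr1// ler_powR//; lra.
have pow_le x y j : 0 <= x -> x <= expR y -> x ^+ j <= expR (j%:R * y).
  by move=> x0 xy; rewrite expRM_natl lerXn2r// nnegrE expR_ge0.
have q_ge0 : 0 <= q by exact: le_trans q_ge1.
exists r, k; split => //.
- apply: le_lt_trans (_ : expR (r%:R * (- (alpha / 16))) * expR L < 1).
    apply: ler_pM => //; first by rewrite exprn_ge0//; lra.
    by apply: pow_le; [lra|exact: expR_ge1Dx].
  rewrite -expRD -[ltRHS]expR0 ltr_expR.
  move: r_gt; rewrite ltr_pdivrMr//; lra.
- move: k_gt; rewrite ltr_pdivrMr// => /ltW; rewrite !exprS; lra.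
(* This uses [4 / alpha <= expR (4 / alpha)] and [1 <= L]. *)
have qk : q / (alpha / 4) <= expR (L * (1 + 4 / alpha)).
  apply: le_trans (_ : expR L * expR (4 / alpha) <= _).
    rewrite invf_div; apply: ler_pM => //.
    by have := expR_ge1Dx (4 / alpha); lra.
  by rewrite -expRD ler_expR mulrDr mulr1 lerD2l ler_peMl.
apply: le_trans (_ : expR (r%:R * L) * (expR (k%:R * (L * (1 + 4 / alpha))) *
   expR (d%:R * L) * expR ((n - d)%:R * (- (alpha / 2))) *
   expR (n%:R * (alpha / 4))) <= _).
  have P x j : 0 <= x -> 0 <= x ^+ j by exact: exprn_ge0.
  have E x : 0 <= expR x by exact: expR_ge0.
  have q4 : 0 <= q / (alpha / 4) by rewrite !divr_ge0.
  have a2 : 0 <= 1 - alpha / 2 by lra.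
  have a4 : 0 <= 1 + alpha / 4 by lra.
  apply: ler_pM; rewrite ?mulr_ge0 ?P ?pow_le//.
  apply: ler_pM; rewrite ?mulr_ge0 ?P ?pow_le ?expR_ge1Dx//.
  apply: ler_pM; rewrite ?mulr_ge0 ?P ?pow_le ?expR_ge1Dx//.
  by apply: ler_pM; rewrite ?mulr_ge0 ?P ?pow_le ?expR_ge1Dx.
rewrite -!expRD ler_expR natrB//.
have rL : r%:R * L <= Cr * L ^+ 3.
  apply: le_trans (_ : Cr * L * L <= _); first by rewrite ler_wpM2r.
  by rewrite -mulrA -expr2 ler_wpM2l.
have kL : k%:R * (L * (1 + 4 / alpha)) <= Ck * (1 + 4 / alpha) * L ^+ 3.
  rewrite [leRHS](_ : _ = (Ck * L ^+ 2) * (L * (1 + 4 / alpha))); last by ring.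
  by apply: ler_wpM2r => //; rewrite mulr_ge0 ?addr_ge0.
have dL3 : d%:R * L <= L ^+ 3.
  by apply: le_trans L2_le3; rewrite expr2 ler_wpM2r.
have da : d%:R * (alpha / 2) <= L ^+ 3.
  apply: le_trans (le_trans dL L_le3); rewrite ler_piMr//; lra.
move: C_small; rewrite /C; lra.
Qed.

Local Open Scope classical_set_scope.

(** * From random variables to finite sums *)

Section FiniteLaw.
Variables (R : realType) (dT : measure_display) (T : measurableType dT).
Variable P : probability T R.

Lemma Pr_finite (V : finType) (X : T -> V) (S : pred V) :
  (forall v, measurable [set t | X t = v]) ->
  Pr P [set t | S (X t)] = \sum_(v | S v) Pr P [set t | X t = v].
Proof.
move=> mX; rewrite /Pr sum_fine => [|v _]; last exact: fin_num_measure.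
congr fine.
have -> : [set t | S (X t)] = \bigcup_(v in [set` S]) [set t | X t = v].
  apply/seteqP; split => [t St|t [v /= Sv tv]]; first by exists (X t).
  by rewrite /= tv.
rewrite measure_fin_bigcup//.
- rewrite -[RHS]big_enum/= [RHS]fsbig_seq ?enum_uniq//.
  by apply: eq_fsbigl; apply/seteqP; split => v /=; rewrite mem_enum.
- apply/trivIsetP => v v' _ _ vv'; apply/seteqP; split => // t [/= tv tv'].
  by move: vv'; rewrite -tv -tv' eqxx.
Qed.

Lemma Pr_ge0 (A : set T) : 0 <= Pr P A.
Proof. exact: fine_ge0. Qed.

Lemma Pr_setT : Pr P setT = 1.
Proof. by rewrite /Pr probability_setT. Qed.

Lemma iid_finfun (dT0 : measure_display) (T1 : measurableType dT0)
    (P1 : probability T1 R) (I V : finType) (X : I -> T -> V) (xi : T1 -> V) :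
  iid_copies P P1 X xi ->
  (forall f, measurable [set t | [ffun i => X i t] = f]) /\
  forall f : {ffun I -> V}, Pr P [set t | [ffun i => X i t] = f] =
    \prod_i Pr P1 [set s | xi s = f i].
Proof.
move=> [mX lawX indX].
have E (f : {ffun I -> V}) : [set t | [ffun i => X i t] = f] =
    \bigcap_(i in [set` [set: I]%SET]) (X i @^-1` [set f i]).
  apply/seteqP; split => [t /= <- i _|t tf] /=; first by rewrite ffunE.
  by apply/ffunP => i; rewrite ffunE tf//= inE.
split=> f; rewrite E.
  by apply: fin_bigcap_measurable => // i _; exact: mX.
rewrite indX; apply: eq_big => [i|i _]; first by rewrite inE.
by rewrite lawX.
Qed.

End FiniteLaw.

(** Regrouping the entries by columns factors the sum: each of the first [m] columns contributes
    [linprob mu w 0], every other one its total mass 1. *)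
Lemma orthogonal_columns_prob (R : realType) (F : finFieldType) (mu : F -> R)
    (n m : nat) (w : 'I_n -> F) : \sum_a mu a = 1 -> (m <= n)%N ->
  \sum_(f : {ffun 'I_n * 'I_n -> F} |
      [forall j : 'I_n, (j < m)%N ==> (\sum_i f (i, j) * w i == 0)])
    \prod_ij mu (f ij) = linprob mu w 0 ^+ m.
Proof.
move=> mu1 mn.
pose uncurry (g : {ffun 'I_n -> {ffun 'I_n -> F}}) : {ffun 'I_n * 'I_n -> F} :=
  [ffun ij => g ij.2 ij.1].
pose curry (f : {ffun 'I_n * 'I_n -> F}) : {ffun 'I_n -> {ffun 'I_n -> F}} :=
  [ffun j => [ffun i => f (i, j)]].
have curryK : cancel curry uncurry.
  by move=> f; apply/ffunP => -[i j]; rewrite !ffunE.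
have uncurryK : cancel uncurry curry.
  by move=> g; apply/ffunP => j; apply/ffunP => i; rewrite !ffunE.
rewrite (reindex uncurry) /=; last by exists curry => ? _.
pose H (j : 'I_n) (v : {ffun 'I_n -> F}) : R :=
  if (j < m)%N ==> (\sum_i v i * w i == 0) then \prod_i mu (v i) else 0.
transitivity (\sum_(g : {ffun 'I_n -> {ffun 'I_n -> F}}) \prod_j H j (g j)).
  rewrite big_mkcond; apply: eq_bigr => g _.
  have condE j : (\sum_i uncurry g (i, j) * w i == 0) = (\sum_i g j i * w i == 0).
    by congr (_ == _); apply: eq_bigr => i _; rewrite ffunE.
  case: ifPn => [/forallP g0|]; last first.
    rewrite negb_forall => /existsP[j /negPf jg].
    by rewrite (bigD1 j)//= /H -condE jg mul0r.
  rewrite (eq_bigr (fun ij => mu (g ij.2 ij.1))) => [|ij _]; last by rewrite ffunE.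
  rewrite -(pair_bigA _ (fun i j => mu (g j i))) /= exchange_big.
  by apply: eq_bigr => j _; rewrite /H -condE g0.
rewrite -(bigA_distr_bigA H) -[in RHS](card_ord m) -prodr_const.
rewrite (big_ord_widen n (fun=> linprob mu w 0) mn) [RHS]big_mkcond.
apply: eq_bigr => j _; rewrite /H; case: ifP => _ /=; first by rewrite -big_mkcond.
by rewrite -(bigA_distr_bigA (fun=> mu)) big1.
Qed.

(** * Conclusion by the first moment *)

Theorem theorem1p5 (R : realType) (alpha : R) (halpha : 0 < alpha) :
  exists2 c0 : R, 0 < c0 & forall c : R, 0 < c -> c <= c0 ->
  exists2 c1 : R, 0 < c1 & exists N : nat, forall n : nat, (N <= n)%N ->
  forall (d : nat) (p : nat),
    d%:R <= n%:R `^ c -> prime p -> p%:R <= expR (n%:R `^ c) ->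
  forall (d0 : measure_display) (T0 : measurableType d0)
    (P0 : probability T0 R) (xi : T0 -> 'F_p),
    discrete_rv xi -> balanced P0 alpha xi ->
  forall (d1 : measure_display) (T1 : measurableType d1)
    (P1 : probability T1 R) (M : T1 -> 'M['F_p]_n),
    iid_copies P1 P0 (fun (ij : 'I_n * 'I_n) t => M t ij.1 ij.2) xi ->
  forall (d2 : measure_display) (T2 : measurableType d2)
    (P2 : probability T2 R) (x : 'I_n -> T2 -> 'F_p),
    iid_copies P2 P0 x xi ->
  1 - expR (- c1 * n%:R) <=
  Pr P1 [set t | forall w : 'cV['F_p]_n, w != 0 ->
    orthogonal_to w <<first_cols (n - d) (M t)>>%VS ->
    conc_dev P2 x w <= expR (- (n%:R `^ c))].
Proof.
exists 6^-1; first by rewrite invr_gt0.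
move=> c c_gt0 c_le; exists (alpha / 8); first by rewrite divr_gt0.
have [N N_large] := parameter_choice halpha.
exists N => n n_large d p dL p_pr pL d0 T0 P0 xi xi_rv xi_bal.
move=> d1 T1 P1 M M_iid d2 T2 P2 x x_iid.
set L := n%:R `^ c in dL pL *.
pose mu a := Pr P0 [set s | xi s = a].
have mu_ge0 a : 0 <= mu a := Pr_ge0 P0 _.
have mu_le a : mu a <= 1 - alpha by apply: le_trans xi_bal; exact: le_bigmax.
have mu_sum1 : \sum_a mu a = 1.
  rewrite -(Pr_finite P0 (X := xi) xpredT); last first.
    by move=> a; exact: (xi_rv [set a]).
  by rewrite -(Pr_setT P0); congr (Pr P0 _); apply/seteqP.
have alpha_le1 : alpha <= 1 by have := le_trans (mu_ge0 0) (mu_le 0); lra.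
have card_Fp : #|'F_p| = p by exact: card_Fp.
set q : R := #|'F_p|%:R.
have q_ge1 : 1 <= q by rewrite ler1n card_Fp prime_gt0.
have q_le : q <= expR L by rewrite /q card_Fp.
have [r [k [dn r_large k_large small]]] :=
  N_large n n_large c q d c_gt0 c_le alpha_le1 dL q_ge1 q_le.
have [e [eD e_norm e_sum]] := exists_additive_character R[i] p_pr.
have [M_meas M_law] := iid_finfun M_iid.
have [x_meas x_law] := iid_finfun x_iid.
have x_linprob (w : 'cV['F_p]_n) a :
    Pr P2 [set t | \sum_(i < n) x i t * w i 0 = a] = linprob mu (fun i => w i 0) a.
  pose S (v : {ffun 'I_n -> 'F_p}) := \sum_i v i * w i 0 == a.
  rewrite (_ : [set t | _] = [set t | S [ffun i => x i t]]); last first.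
    have SE t : \sum_i [ffun i => x i t] i * w i 0 = \sum_i x i t * w i 0.
      by apply: eq_bigr => i _; rewrite ffunE.
    by apply/seteqP; split => t /=; rewrite /S SE => /eqP.
  transitivity (\sum_(v | S v) Pr P2 [set t | [ffun i => x i t] = v]).
    exact: Pr_finite.
  by apply: eq_bigr => v _; exact: x_law.
pose good (A : 'M['F_p]_n) := forall w : 'cV['F_p]_n, w != 0 ->
  orthogonal_to w <<first_cols (n - d) A>>%VS -> conc_dev P2 x w <= expR (- L).
pose mx (f : {ffun 'I_n * 'I_n -> 'F_p}) : 'M['F_p]_n := \matrix_(i, j) f (i, j).
pose goodb f := `[< good (mx f) >].
have M_ffun t : mx [ffun ij => M t ij.1 ij.2] = M t.
  by apply/matrixP => i j; rewrite mxE ffunE.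
rewrite [X in Pr P1 X](_ : _ = [set t | goodb [ffun ij => M t ij.1 ij.2]]); last first.
  apply/seteqP; split => t /=; rewrite /goodb M_ffun; first by move=> ?; apply/asboolP.
  by move/asboolP.
pose law (f : {ffun 'I_n * 'I_n -> 'F_p}) := \prod_ij mu (f ij).
have law_ge0 f : 0 <= law f by apply: prodr_ge0.
have law_sum1 : \sum_f law f = 1 by rewrite -(bigA_distr_bigA (fun=> mu)) big1.
rewrite [leRHS](_ : _ = \sum_(f | goodb f) law f); last first.
  transitivity (\sum_(f | goodb f) Pr P1 [set t | [ffun ij => M t ij.1 ij.2] = f]).
    exact: Pr_finite.
  by apply: eq_bigr => f _; exact: M_law.
(* After passing to the complement, it remains to bound the mass of the matrices that are not
   good. *)
rewrite lerBlDr -[leLHS]law_sum1 (bigID goodb) /= lerD2l.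
apply: le_trans small.
pose bad (w : {ffun 'I_n -> 'F_p}) := `[< (exists i, w i != 0) /\
  exists a, expR (- L) < `|linprob mu w a - q^-1| >].
have n_split : (#|'I_n| = (n - d) + d)%N by rewrite card_ord subnK.
have eta_gt0 : 0 < alpha / 4 by rewrite divr_gt0.
have eta_le1 : alpha / 4 <= 1 by lra.
have badP w : bad w -> (exists i, w i != 0) /\
  exists a, expR (- L) < `|linprob mu w a - q^-1| by move/asboolP.
have moment := bad_moment_sum p_pr halpha mu_ge0 mu_sum1 mu_le eD e_norm e_sum q_le r_large
  k_large n_split eta_gt0 eta_le1 badP.
rewrite (card_ord n) -/q in moment; apply: le_trans moment.
(* Each power becomes the probability that the first [n - d] columns are orthogonal to [w]. After
   the exchange of sums, it suffices to find one such bad [w] for each matrix that is not good. *)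
under [leRHS]eq_bigr do rewrite -orthogonal_columns_prob ?leq_subr//.
rewrite (exchange_big_dep xpredT) //= big_mkcond; apply: ler_sum => f _.
case: ifPn => [|_]; last by apply: sumr_ge0 => ? _; exact: law_ge0.
move=> /asboolPn /existsNP[w /not_implyP[w0 /not_implyP[w_orth w_dev]]].
pose v : {ffun 'I_n -> 'F_p} := [ffun i => w i 0].
rewrite (bigD1 v) /=; first by rewrite lerDl; apply: sumr_ge0 => ? _; exact: law_ge0.
apply/andP; split.
  apply/asboolP; split.
    apply: contrapT => v0; move/eqP: w0; apply; apply/matrixP => i j.
    rewrite ord1 mxE; apply/eqP; apply: contrapT => /negP wi.
    by apply: v0; exists i; rewrite ffunE.
  (* Bounding a [sup] by its upper bounds needs a nonempty set, hence the witness [a = 0]. *)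
  apply: contrapT => va; apply: w_dev; apply: ge_sup; first by eexists; exists 0.
  move=> _ [a _ <-]; rewrite leNgt; apply/negP => wa; apply: va; exists a.
  move: wa; rewrite x_linprob /q card_Fp; congr (_ < `|_ - _|).
  by apply: eq_bigl => u; congr (_ == _); apply: eq_bigr => i _; rewrite ffunE.
apply/forallP => j; apply/implyP => jd; apply/eqP.
rewrite -[RHS](w_orth (col j (mx f))).
  by apply: eq_bigr => i _; rewrite !mxE ffunE.
apply: memv_span; apply/mapP; exists j => //.
by rewrite mem_filter jd mem_enum inE.
Qed.
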